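(* Let $n$ be an integer with $n\geq 2$, and let $\mathsf{K}$ be a variety of Heyting algebras all of whose members have width at most $n$. If $\boldsymbol{X}_{n}^{\infty}\in\mathsf{K}_\ast$, then $\mathsf{K}$ lacks the ES property.
   Context: Heyting algebras are algebras $\langle A;\wedge,\vee,\to,0,1\rangle$; varieties are regarded as categories with homomorphisms as morphisms. A homomorphism $f\colon \mathbf{A}\to\mathbf{B}$ in a variety $\mathsf{K}$ is an epimorphism if for all $\mathbf{C}\in\mathsf{K}$ and homomorphisms $g,h\colon\mathbf{B}\to\mathbf{C}$, $g\circ f=h\circ f$ implies $g=h$; $\mathsf{K}$ has the ES property if every epimorphism in $\mathsf{K}$ is surjective. An Esakia space is a Stone space with a partial order such that ${\uparrow}x$ is closed for every $x$ and ${\downarrow}U$ is clopen for every clopen $U$. For a Heyting algebra $\mathbf{A}$, $\mathbf{A}_\ast$ is its dual Esakia space: prime filters ordered by inclusion, with topology generated by the sets $\{F: a\in F\}$ and $\{F: a\notin F\}$, $a\in A$. For a variety $\mathsf{K}$, $\mathsf{K}_\ast$ is the class of Esakia spaces homeomorphically order-isomorphic to $\mathbf{A}_\ast$ for some $\mathbf{A}\in\mathsf{K}$ (equivalently, Esakia spaces $\boldsymbol{X}$ whose Heyting algebra $\boldsymbol{X}^\ast$ of clopen upsets belongs to $\mathsf{K}$). A poset has width at most $n$ if for every element $x$, ${\uparrow}x$ contains no antichain of $n+1$ elements; a Heyting algebra has width at most $n$ if the poset underlying $\mathbf{A}_\ast$ does. For $n\geq 2$, $\mathbb{X}_n$ is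 the poset with universe $\{a_1,\dots,a_n,b_1,\dots,b_n\}$ where $x\leq y$ iff $x=y$, or $x=a_1$ and $y\in\{b_2,\dots,b_n\}$, or $x=a_m$ for some $m>1$ and $y\in\{b_1,b_m\}$; $\boldsymbol{X}_n$ is $\mathbb{X}_n$ with the discrete topology. For Esakia spaces $\boldsymbol{X}_k$ ($k\in\omega$) with disjoint universes, $\sum\boldsymbol{X}_k$ has universe $\{\top\}\cup\bigcup_k X_k$ ($\top$ fresh), order $x\leq y$ iff $y=\top$, or $x,y\in X_k$ with $x\leq y$ in $\boldsymbol{X}_k$, or $x\in X_k$, $y\in X_m$ with $k<m$; and topology consisting of the sets $U$ such that every $U\cap X_k$ is open in $\boldsymbol{X}_k$ and, if $\top\in U$, then $\bigcup_{m\geq k}X_m\subseteq U$ for some $k$. $\boldsymbol{X}^\infty$ is the sum of $\omega$ copies of $\boldsymbol{X}$. *)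

(* Defs.v *)
From HB Require Import structures.
From mathcomp Require Import all_boot all_order.
From mathcomp Require Import all_classical topology.

Set Implicit Arguments.
Unset Strict Implicit.
Unset Printing Implicit Defensive.

Import Order.TTheory.

Local Open Scope classical_set_scope.
Local Open Scope order_scope.

HB.mixin Record hasHeytingImp d (T : Type) of Order.TBLattice d T := {
  himp : T -> T -> T;
  himpP : forall a b c : T, (a `&` b <= c) = (a <= himp b c)
}.

#[short(type="heytingType")]
HB.structure Definition Heyting d :=
  { T of Order.TBLattice d T & hasHeytingImp d T }.

Record heyting_hom {d d'} {A : heytingType d} {B : heytingType d'}
    (f : A -> B) : Prop := HeytingHom {
  hom_meet : forall a b, f (a `&` b) = f a `&` f b;
  hom_join : forall a b, f (a `|` b) = f a `|` f b;
  hom_imp : forall a b, f (himp a b) = himp (f a) (f b);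
  hom_bot : f \bot = \bot;
  hom_top : f \top = \top
}.

Inductive hterm :=
  | Var of nat
  | Meet of hterm & hterm
  | Join of hterm & hterm
  | Imp of hterm & hterm
  | Bot
  | Top.

Fixpoint heval {d} {A : heytingType d} (v : nat -> A) (t : hterm) : A :=
  match t with
  | Var i => v i
  | Meet s u => heval v s `&` heval v u
  | Join s u => heval v s `|` heval v u
  | Imp s u => himp (heval v s) (heval v u)
  | Bot => \bot
  | Top => \top
  end.

(* The order display d is a notational tag without mathematical content; a
   class of Heyting algebras ranges over all of them. *)
Definition heytingClass := forall d : Order.disp_t, heytingType d -> Prop.

Definition variety (K : heytingClass) :=
  exists E : set (hterm * hterm), forall d (A : heytingType d),
    K d A <-> forall e, E e -> forall v : nat -> A, heval v e.1 = heval v e.2.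

Definition epimorphism (K : heytingClass) {d d'}
    {A : heytingType d} {B : heytingType d'} (f : A -> B) :=
  forall d'' (C : heytingType d'') (g h : B -> C),
    K d'' C -> heyting_hom g -> heyting_hom h -> g \o f = h \o f -> g = h.

Definition ES_property (K : heytingClass) :=
  forall d d' (A : heytingType d) (B : heytingType d') (f : A -> B),
    K d A -> K d' B -> heyting_hom f -> epimorphism K f ->
    forall b : B, exists a : A, f a = b.

Definition poset_width_le {d} (n : nat) (X : porderType d) :=
  forall x : X, ~ exists s : 'I_n.+1 -> X,
    (forall i, x <= s i) /\ (forall i j, i != j -> s i >< s j).

Notation ordSpaceType := POrderedTopological.type.

Record esakia {d} (X : ordSpaceType d) : Prop := Esakia {
  esakia_compact : compact [set: X];
  esakia_hausdorff : hausdorff_space X;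
  esakia_disconnected : totally_disconnected [set: X];
  esakia_up : forall x : X, closed [set y : X | x <= y];
  esakia_down : forall U : set X, clopen U ->
    clopen [set x : X | exists2 y, U y & x <= y]
}.

Definition esakia_iso {d d'} (X : ordSpaceType d) (Y : ordSpaceType d') :=
  exists f : X -> Y, exists g : Y -> X,
    [/\ cancel f g, cancel g f, continuous f, continuous g
      & {mono f : x y / x <= y}].

Record prime_filter {d} {A : heytingType d} (F : set A) : Prop := PrimeFilter {
  pf_top : F \top;
  pf_bot : ~ F \bot;
  pf_up : forall a b, F a -> a <= b -> F b;
  pf_meet : forall a b, F a -> F b -> F (a `&` b);
  pf_prime : forall a b, F (a `|` b) -> F a \/ F b
}.

Definition dual {d} (A : heytingType d) := {F : set A | `[< prime_filter F >]}.

Section DualSpace.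
Context {d : Order.disp_t} {A : heytingType d}.

HB.instance Definition _ := Choice.on (dual A).

Definition dual_le (F G : dual A) : bool := `[< val F `<=` val G >].

Fact dual_le_refl : reflexive dual_le.
Proof. by move=> F; apply/asboolP. Qed.

Fact dual_le_anti : antisymmetric dual_le.
Proof.
move=> F G /andP[/asboolP FG /asboolP GF].
by apply: val_inj; apply/seteqP; split.
Qed.

Fact dual_le_trans : transitive dual_le.
Proof.
move=> G F H /asboolP FG /asboolP GH; apply/asboolP.
exact: subset_trans FG GH.
Qed.

HB.instance Definition _ :=
  Order.Le_isPOrder.Build d (dual A) dual_le_refl dual_le_anti dual_le_trans.

Definition dual_subbase : set_system (dual A) :=
  [set U | exists a : A, U = [set F : dual A | val F a] \/
                         U = [set F : dual A | ~ val F a]].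

HB.instance Definition _ :=
  isSubBaseTopological.Build (dual A) dual_subbase id.

End DualSpace.

Definition heyting_width_le {d} (n : nat) (A : heytingType d) :=
  poset_width_le n (dual A).

Definition dual_class (K : heytingClass) {d} (X : ordSpaceType d) :=
  esakia X /\
  exists (d' : Order.disp_t) (A : heytingType d'), K d' A /\ esakia_iso (dual A) X.

(* None is the added top element; Some (Tagged X x) with x : X k is the element
   x of the k-th summand. *)
Definition sumspace {d} (X : nat -> ordSpaceType d) := option {k : nat & X k}.

Section SumSpace.
Context {d : Order.disp_t} {X : nat -> ordSpaceType d}.

HB.instance Definition _ := Choice.on (sumspace X).

Definition sum_le (x y : sumspace X) : bool :=
  match x, y with
  | _, None => true
  | None, Some _ => false
  | Some u, Some v =>
      (tag u < tag v)%N ||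
      ((tag u == tag v) && (tagged u <= tagged_as u v))
  end.

Fact sum_le_refl : reflexive sum_le.
Proof. by case=> [[k x]|] //=; rewrite tagged_asE eqxx lexx orbT. Qed.

Fact sum_le_anti : antisymmetric sum_le.
Proof.
case=> [[k x]|] [[m y]|] //= /andP[/orP[km|/andP[/eqP/= km xy]]].
  by case/orP => [mk|/andP[/eqP/= mk]];
    [have := ltn_trans km mk; rewrite ltnn | rewrite mk ltnn in km].
case: m / km y xy => y; rewrite ltnn !tagged_asE eqxx /= => xy yx.
by congr (Some (Tagged _ _)); apply/le_anti; rewrite xy yx.
Qed.

Fact sum_le_trans : transitive sum_le.
Proof.
case=> [[m y]|] [[k x]|] [[l z]|] //=.
case/orP => [km|/andP[/eqP/= km xy]].
  have [ml _|_ /=] := ltnP m l; first by rewrite (ltn_trans km ml).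
  by case/andP=> /eqP ml _; have -> : (k < l)%N by rewrite -ml.
case: m / km y xy => y; rewrite !tagged_asE => xy.
case/orP => [-> //|/andP[/eqP/= kl]].
case: l / kl z => z; rewrite !tagged_asE eqxx => yz.
by rewrite (le_trans xy yz) orbT.
Qed.

HB.instance Definition _ :=
  Order.Le_isPOrder.Build d (sumspace X) sum_le_refl sum_le_anti sum_le_trans.

Definition sum_open : set_system (sumspace X) := [set U |
  (forall k, open [set x : X k | U (Some (Tagged X x))]) /\
  (U None -> exists k, forall m (x : X m), (k <= m)%N -> U (Some (Tagged X x)))].

Fact sum_openT : sum_open setT.
Proof. by split=> [k|_]; [exact: openT | exists 0]. Qed.

Fact sum_openI : setI_closed sum_open.
Proof.
move=> U V [oU tU] [oV tV]; split=> [k|[/tU[k Uk] /tV[l Vl]]].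
  exact: openI.
exists (maxn k l) => m x; rewrite geq_max => /andP[km lm].
by split; [exact: Uk | exact: Vl].
Qed.

Fact sum_open_bigU (I : Type) (f : I -> set (sumspace X)) :
  (forall i, sum_open (f i)) -> sum_open (\bigcup_i f i).
Proof.
move=> of_; split=> [k|[i _ fi]].
  rewrite (_ : [set _ | _] =
    \bigcup_i [set x : X k | f i (Some (Tagged X x))]) //.
  by apply: bigcup_open => i _; exact: (of_ i).1.
by have [k fk] := (of_ i).2 fi; exists k => m x km; exists i => //; exact: fk.
Qed.

HB.instance Definition _ :=
  isOpenTopological.Build (sumspace X) sum_openT sum_openI sum_open_bigU.

End SumSpace.

Definition omega_sum {d} (X : ordSpaceType d) := sumspace (fun=> X).

(* a_(i+1) is inl i and b_(i+1) is inr i. *)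
Definition XX (n : nat) := ('I_n + 'I_n)%type.

Section XX.
Context {n : nat}.

HB.instance Definition _ := Choice.on (XX n).

Definition XX_le (x y : XX n) : bool :=
  (x == y) ||
  match x, y with
  | inl i, inr j =>
      if i == 0 :> nat then j != 0 :> nat
      else (j == 0 :> nat) || (j == i)
  | _, _ => false
  end.

Fact XX_le_refl : reflexive XX_le.
Proof. by move=> x; rewrite /XX_le eqxx. Qed.

Fact XX_le_anti : antisymmetric XX_le.
Proof. by case=> i [] j /andP[/orP[/eqP//|] //= _ /orP[/eqP//|]]. Qed.

Fact XX_le_trans : transitive XX_le.
Proof.
move=> y x z /orP[/eqP-> //|xy] /orP[/eqP<-|yz].
  by rewrite /XX_le xy orbT.
by case: x y z xy yz => i [] j [] k.
Qed.

HB.instance Definition _ := Order.Le_isPOrder.Build (Order.Disp tt tt) (XX n)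
  XX_le_refl XX_le_anti XX_le_trans.

HB.instance Definition _ := hasNbhs.Build (XX n) principal_filter.
HB.instance Definition _ := Discrete_ofNbhs.Build (XX n) erefl.

End XX.

(* Main.v *)
Require Import Defs.
From HB Require Import structures.
From mathcomp Require Import all_boot all_order all_classical topology.

(** Write a_m^k, b_m^k for the points of the k-th copy of X_n in X := X_n^oo,
    and let A be an algebra in K with dual space X. The map sending b_1^k to
    a_1^(k+1), a_m^k to b_m^k for m > 1, and fixing all other points is a
    closure operator on X; the elements of A whose clopen upsets are unions of
    its fibres therefore form a subalgebra, which is proper since a_2^0 and
    b_2^0 lie in one fibre. Its inclusion into A is an epimorphism: if two
    homomorphisms from A to C agree on it, their dual maps G, H : C_* -> X are
    p-morphisms that agree up to fibres. Were they to differ, some point v would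
    satisfy, up to symmetry, G v = a_m^k and H v = b_m^k with m > 1; lifting
    points of X along G and H then yields an antichain of n + 1 elements above
    v, contradicting the width bound on C. *)

Set Implicit Arguments.
Unset Strict Implicit.
Unset Printing Implicit Defensive.

Import Order.TTheory.

(** * Filters, ideals and the prime filter theorem *)

Section PrimeFilters.
Local Open Scope classical_set_scope.
Local Open Scope order_scope.
Context {d : Order.disp_t} {A : heytingType d}.
Implicit Types (F I : set A) (a b c : A).

Record is_filter F : Prop := IsFilter {
  filter_top : F \top;
  filter_up : forall a b, F a -> a <= b -> F b;
  filter_meet : forall a b, F a -> F b -> F (a `&` b)
}.

Record is_ideal I : Prop := IsIdeal {
  ideal_bot : I \bot;
  ideal_down : forall a b, I b -> a <= b -> I a;
  ideal_join : forall a b, I a -> I b -> I (a `|` b)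
}.

Lemma prime_is_filter F : prime_filter F -> is_filter F.
Proof. by case. Qed.

Lemma ideal_principal c : is_ideal [set a | a <= c].
Proof.
split=> [|a b /[swap]|a b /= ac bc]; [exact: le0x|exact: le_trans|].
by rewrite leUx ac.
Qed.

Lemma himp_mp a b : himp a b `&` a <= b.
Proof. by rewrite himpP. Qed.

Lemma filter_mp F a b : is_filter F -> F (himp a b) -> F a -> F b.
Proof.
by move=> fF Fab Fa; apply: (filter_up fF) (himp_mp a b); apply: filter_meet.
Qed.

(** This is the filter generated by [F] and [a]. *)
Lemma filter_himp F a : is_filter F -> is_filter [set b | F (himp a b)].
Proof.
move=> fF; split=> [|b c /= Fb bc|b c /= Fb Fc] /=.
- by apply: (filter_up fF) (filter_top fF) _; rewrite -himpP lex1.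
- by apply: (filter_up fF) Fb _; rewrite -himpP (le_trans (himp_mp _ _)).
- apply: (filter_up fF) (filter_meet fF Fb Fc) _.
  rewrite -himpP lexI; apply/andP; split.
    by apply: le_trans (himp_mp a b); rewrite leI2 ?leIl.
  by apply: le_trans (himp_mp a c); rewrite leI2 ?leIr.
Qed.

Lemma sub_filter_himp F a : is_filter F -> F `<=` [set b | F (himp a b)].
Proof. by move=> fF b Fb; apply: (filter_up fF) Fb _; rewrite -himpP leIl. Qed.

Lemma filter_himp_self F a : is_filter F -> F (himp a a).
Proof.
by move=> fF; apply: (filter_up fF) (filter_top fF) _; rewrite -himpP leIr.
Qed.

(** Zorn's lemma gives a filter maximal among those containing [F] and disjoint from [I]; maximality
    makes it prime. *)
Lemma filter_ideal_prime F I : is_filter F -> is_ideal I ->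
    (forall a, F a -> ~ I a) ->
  exists P, [/\ prime_filter P, F `<=` P & forall a, P a -> ~ I a].
Proof.
move=> fF iI FI.
pose good G := [/\ is_filter G, F `<=` G & forall a, G a -> ~ I a].
(* The disjunct [G = set0] makes the empty chain admissible. *)
have [|M [+ Mmax]] := @Zorn_bigcup A [set G | G = set0 \/ good G].
  move=> C Cgood Ctot; have [[G [CG G0]]|noG] := pselect (exists G, C G /\ G != set0).
  2: { left; apply/seteqP; split=> // a [G CG Ga]; apply: noG.
       by exists G; split=> //; apply/set0P; exists a. }
  have gG : good G by case: (Cgood _ CG) G0 => [->|//]; rewrite eqxx.
  right; split.
  - split.
    + by exists G => //; case: gG => fG _ _; apply: filter_top.
    + move=> a b [H CH Ha] ab; exists H => //.
      have [H0|[fH _ _]] := Cgood _ CH; first by rewrite H0 in Ha.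
      exact: filter_up Ha ab.
    + move=> a b [H CH Ha] [J CJ Jb].
      have [H0|[fH _ _]] := Cgood _ CH; first by rewrite H0 in Ha.
      have [J0|[fJ _ _]] := Cgood _ CJ; first by rewrite J0 in Jb.
      have [HJ|JH] := Ctot _ _ CH CJ.
        by exists J => //; apply: filter_meet => //; apply: HJ.
      by exists H => //; apply: filter_meet => //; apply: JH.
  - by case: gG => _ FG _ a Fa; exists G => //; apply: FG.
  - move=> a [H CH Ha].
    by have [H0|[_ _]] := Cgood _ CH; [rewrite H0 in Ha | apply].
case=> [M0|[fM FM MI]].
  exfalso; apply: (Mmax F); last by right; split.
  by rewrite M0; split=> // /(_ _ (filter_top fF)).
exists M; split=> //.
(* The filter generated by [M] and [a] properly extends [M], so it meets [I]. *)
have ext a : ~ M a -> exists2 i, I i & M (himp a i).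
  move=> nMa; have := Mmax [set b | M (himp a b)].
  have sM : M `<` [set b | M (himp a b)].
    split; first exact: sub_filter_himp.
    by move=> /(_ a) /(_ (filter_himp_self a fM)).
  move=> /(_ sM) ng; apply: contrapT => nI; apply: ng; right; split.
  - exact: filter_himp.
  - by move=> b Fb; apply: sub_filter_himp => //; apply: FM.
  - by move=> b Mb Ib; apply: nI; exists b.
split; [exact: filter_top | by move=> /MI; apply; apply: ideal_bot
       | exact: filter_up | exact: filter_meet | ].
(* With a → i and b → j in [M], so is a ∨ b → i ∨ j, which would put i ∨ j in both [M] and [I]. *)
move=> a b Mab; apply: contrapT => /not_orP[/ext[i Ii Mi] /ext[j Ij Mj]].
apply: (MI (i `|` j)); last exact: ideal_join.
apply: (filter_mp fM) Mab.
apply: (filter_up fM) (filter_meet fM Mi Mj) _.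
rewrite -himpP meetC himpP leUx -!himpP ![_ `&` (_ `&` _)]meetC; apply/andP; split.
  by rewrite (le_trans _ (leUl i j)) // (le_trans _ (himp_mp a i)) // leI2 ?leIl.
by rewrite (le_trans _ (leUr j i)) // (le_trans _ (himp_mp b j)) // leI2 ?leIr.
Qed.

Lemma prime_himp_ext F a b : prime_filter F -> ~ F (himp a b) ->
  exists P, [/\ prime_filter P, F `<=` P, P a & ~ P b].
Proof.
move=> /prime_is_filter fF nFab.
have [c /= Fc cb|P [pP FP Pb]] :=
  filter_ideal_prime (filter_himp a fF) (ideal_principal b).
  apply: nFab; apply: (filter_up fF) Fc _.
  by rewrite -himpP (le_trans (himp_mp _ _)).
exists P; split=> //; last by move/Pb; apply; exact: lexx.
  by move=> c Fc; apply: FP; apply: sub_filter_himp.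
by apply: FP; exact: filter_himp_self.
Qed.

Lemma prime_separation a b : ~~ (a <= b) ->
  exists P, [/\ prime_filter P, P a & ~ P b].
Proof.
move=> nab; have fa : is_filter [set c | a <= c].
  split=> [|c e|c e /= ac ae] /=; [exact: lex1|exact: le_trans|].
  by rewrite lexI ac.
have [c /= ac cb|P [pP aP Pb]] := filter_ideal_prime fa (ideal_principal b).
  by rewrite (le_trans ac cb) in nab.
by exists P; split=> //; [apply: aP => /= | move/Pb; apply; exact: lexx].
Qed.

End PrimeFilters.

(** * The p-morphism dual to a homomorphism *)

Section DualMap.
Local Open Scope classical_set_scope.
Local Open Scope order_scope.
Context {d d' : Order.disp_t} {A : heytingType d} {B : heytingType d'}.
Variables (f : A -> B) (hf : heyting_hom f).

Lemma hom_le a b : a <= b -> f a <= f b.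
Proof. by rewrite !leEmeet -(hom_meet hf) => /eqP->. Qed.

Lemma preimage_prime_filter (P : set B) :
  prime_filter P -> prime_filter (f @^-1` P).
Proof.
move=> pP; split=> [||a b Pa ab|a b Pa Pb|a b] /=.
- by rewrite (hom_top hf); apply: pf_top.
- by rewrite (hom_bot hf); apply: pf_bot.
- exact: (pf_up pP) (hom_le ab).
- by rewrite (hom_meet hf); apply: pf_meet.
- by rewrite (hom_join hf); apply: pf_prime.
Qed.

Lemma dual_map_subproof (P : dual B) : `[< prime_filter (f @^-1` val P) >].
Proof. by apply/asboolP/preimage_prime_filter/asboolP/(valP P). Qed.

Definition dual_map (P : dual B) : dual A :=
  exist _ (f @^-1` val P) (dual_map_subproof P).

Lemma dual_map_homo : {homo dual_map : P Q / P <= Q}.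
Proof. by move=> P Q /asboolP PQ; apply/asboolP => a; apply: PQ. Qed.

(** This is the back condition of a p-morphism. A prime filter containing [P] and all f q with q in
    [Q], but no f r with r outside [Q], has preimage exactly [Q]. *)
Lemma dual_map_lift (P : dual B) (Q : dual A) : dual_map P <= Q ->
  exists2 P', P <= P' & dual_map P' = Q.
Proof.
move=> /asboolP /= PQ; have /asboolP pP := valP P; have /asboolP pQ := valP Q.
pose F := [set c | exists p q, [/\ val P p, val Q q & p `&` f q <= c]].
pose I := [set c | exists2 r, ~ val Q r & c <= f r].
have fF : is_filter F.
  split.
  - by exists \top, \top; split; [apply: pf_top | apply: pf_top | apply: lex1].
  - by move=> a b [p [q [Pp Qq pa]]] ab; exists p, q; split=> //; apply: le_trans ab.
  - move=> a b [p [q [Pp Qq pa]]] [p' [q' [Pp' Qq' pb]]].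
    exists (p `&` p'), (q `&` q'); split; [exact: pf_meet | exact: pf_meet | ].
    by rewrite (hom_meet hf) meetACA leI2.
have iI : is_ideal I.
  split.
  - by exists \bot; [apply: pf_bot | apply: le0x].
  - by move=> a b [r Qr br] ab; exists r => //; apply: le_trans br.
  - move=> a b [r Qr ar] [s Qs bs]; exists (r `|` s).
      by move/(pf_prime pQ) => -[].
    by rewrite (hom_join hf) leU2.
have [c [p [q [Pp Qq pc]]] [r Qr cr]|P' [pP' FP' P'I]] := filter_ideal_prime fF iI.
  (* From p ∧ f q ≤ f r follows p ≤ f (q → r); so q → r lies in the preimage of [P], hence in [Q],
     and then so does r. *)
  apply: Qr; apply: (filter_mp (prime_is_filter pQ)) (Qq).
  apply: PQ; rewrite /= (hom_imp hf); apply: (pf_up pP) Pp _.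
  by rewrite -himpP (le_trans pc).
have P'P : `[< prime_filter P' >] by apply/asboolP.
exists (exist _ P' P'P).
  apply/asboolP => /= p Pp; apply: FP'; exists p, \top.
  by split; [|exact: pf_top|exact: leIl].
apply: val_inj => /=; apply/seteqP; split=> [a /= P'a|a Qa /=].
  by apply: contrapT => Qa; apply: (P'I _ P'a); exists a.
by apply: FP'; exists \top, a; split; [exact: pf_top| |exact: leIr].
Qed.

End DualMap.

(** * Subalgebras and their membership in a variety *)

Section Subalgebra.
Local Open Scope classical_set_scope.
Local Open Scope order_scope.

Record heyting_closed {d} {A : heytingType d} (S : set A) : Prop :=
  HeytingClosed {
    closed_meet : forall a b, S a -> S b -> S (a `&` b);
    closed_join : forall a b, S a -> S b -> S (a `|` b);
    closed_imp : forall a b, S a -> S b -> S (himp a b);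
    closed_bot : S \bot;
    closed_top : S \top
  }.

(** The closure proof is a parameter of the type, so that the Heyting structure can be attached to
    it by instances. *)
Definition subalgebra {d} {A : heytingType d} (S : set A)
  of heyting_closed S := {a : A | a \in S}.

Context {d : Order.disp_t} {A : heytingType d} {S : set A}.
Variable cS : heyting_closed S.
Notation T := (subalgebra cS).

HB.instance Definition _ := SubChoice.on T.

Fact subalgebra_meet : {in S &, forall u v, u `&` v \in S}.
Proof. by move=> a b /set_mem Sa /set_mem Sb; apply/mem_set/(closed_meet cS). Qed.

Fact subalgebra_join : {in S &, forall u v, u `|` v \in S}.
Proof. by move=> a b /set_mem Sa /set_mem Sb; apply/mem_set/(closed_join cS). Qed.

HB.instance Definition _ := Order.SubChoice_isTBSubLattice.Build d A (mem S) d T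
  subalgebra_meet subalgebra_join
  (mem_set (closed_bot cS)) (mem_set (closed_top cS)).

Fact subalgebra_imp_subproof (a b : T) : himp (val a) (val b) \in S.
Proof. by apply/mem_set/(closed_imp cS) => //; apply/set_mem/valP. Qed.

Definition subalgebra_imp (a b : T) : T :=
  exist _ (himp (val a) (val b)) (subalgebra_imp_subproof a b).

Fact subalgebra_impP (a b c : T) : (a `&` b <= c) = (a <= subalgebra_imp b c).
Proof. exact: himpP. Qed.

HB.instance Definition _ := hasHeytingImp.Build d T subalgebra_impP.

Lemma subalgebra_hom : heyting_hom (val : T -> A).
Proof. by split. Qed.

Lemma heval_hom {d1 d2} {B : heytingType d1} {C : heytingType d2} (f : B -> C)
  (v : nat -> B) t : heyting_hom f -> f (heval v t) = heval (f \o v) t.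
Proof.
case=> fI fU fi f0 f1.
by elim: t => //= [s IHs u IHu|s IHs u IHu|s IHs u IHu];
  rewrite ?fI ?fU ?fi IHs IHu.
Qed.

Lemma subalgebra_variety (K : heytingClass) : variety K -> K d A -> K d T.
Proof.
move=> [E KE] /KE KA; apply/KE => e Ee v; apply: val_inj.
by rewrite !(heval_hom _ _ subalgebra_hom); apply: KA.
Qed.

End Subalgebra.

(** * The order of X_n^oo and its closure operator *)

Section OmegaSumXX.
Local Open Scope order_scope.
Context {n : nat}.
Implicit Types (i j : 'I_n) (k m : nat).
Notation X := (omega_sum (XX n)).

Definition pt k (x : XX n) : X := Some (existT (fun=> XX n) k x).

Lemma pt_inj k m x y : pt k x = pt m y -> k = m /\ x = y.
Proof.
move=> e; pose f (u : X) := if u is Some w then (tag w, tagged w) else (k, x).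
by have [-> ->] : f (pt k x) = f (pt m y) by rewrite e.
Qed.

Lemma le_pt k m x y :
  (pt k x <= pt m y) = (k < m)%N || ((k == m) && (x <= y)).
Proof.
rewrite /Order.le /=; case: (eqVneq k m) => [<-|//].
by rewrite tagged_asE.
Qed.

Lemma le_aa i j : ((inl i : XX n) <= inl j) = (i == j).
Proof. by rewrite /Order.le /= /XX_le orbF. Qed.

Lemma le_bb i j : ((inr i : XX n) <= inr j) = (i == j).
Proof. by rewrite /Order.le /= /XX_le orbF. Qed.

Lemma le_ba i j : ((inr i : XX n) <= inl j) = false.
Proof. by []. Qed.

Lemma le_ab i j : ((inl i : XX n) <= inr j) =
  if i == 0 :> nat then j != 0 :> nat else (j == 0 :> nat) || (j == i).
Proof. by []. Qed.

Definition le_ptE := (le_pt, le_aa, le_bb, le_ba, le_ab).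

(* The closure operator whose fibres are the classes {b_1^k, a_1^(k+1)},
   {a_m^k, b_m^k} for m > 1, and the remaining singletons a_1^0 and T. *)
Definition cls (x : X) : X :=
  match x with
  | None => None
  | Some (existT k (inl i)) => if i == 0 :> nat then pt k (inl i) else pt k (inr i)
  | Some (existT k (inr i)) => if i == 0 :> nat then pt k.+1 (inl i) else pt k (inr i)
  end.

Lemma cls_a k i :
  cls (pt k (inl i)) = if i == 0 :> nat then pt k (inl i) else pt k (inr i).
Proof. by []. Qed.

Lemma cls_b k i :
  cls (pt k (inr i)) = if i == 0 :> nat then pt k.+1 (inl i) else pt k (inr i).
Proof. by []. Qed.

Lemma ptP (x : X) : [\/ x = None, exists k i, x = pt k (inl i)
  | exists k i, x = pt k (inr i)].
Proof.
case: x => [[k [i|i]]|]; first by constructor 2; exists k, i.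
  by constructor 3; exists k, i.
by constructor 1.
Qed.

Lemma le_None (x : X) : x <= None.
Proof. by case: x => [[]|]. Qed.

Lemma ord0_inj i j : i == 0 :> nat -> j == 0 :> nat -> i = j.
Proof. by move=> /eqP i0 /eqP j0; apply: val_inj; rewrite /= i0 j0. Qed.

Lemma cls_ge x : x <= cls x.
Proof.
case: (ptP x) => [->|[k [i ->]]|[k [i ->]]]; first by [].
  rewrite cls_a; case: ifP => [//|i0].
  by rewrite !le_ptE i0 !eqxx !orbT.
rewrite cls_b; case: ifP => [i0|//].
by rewrite !le_ptE ltnS leqnn.
Qed.

Lemma cls_idem x : cls (cls x) = cls x.
Proof.
case: (ptP x) => [->|[k [i ->]]|[k [i ->]]]; first by [].
  by rewrite cls_a; case: ifP => i0; rewrite ?cls_a ?cls_b i0.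
by rewrite cls_b; case: ifP => i0; rewrite ?cls_a ?cls_b i0.
Qed.

Lemma cls_homo : {homo cls : x y / x <= y}.
Proof.
move=> x y; case: (ptP y) => [->|[m [j ->]]|[m [j ->]]]; first by move=> _; exact: le_None.
- case: (ptP x) => [->//|[k [i ->]]|[k [i ->]]].
    rewrite !cls_a; case: ifP => i0; case: ifP => j0; rewrite !le_ptE ?i0 ?j0 //=.
    + by rewrite andbT => /orP[->//|/andP[-> _]]; rewrite orbT.
    + by rewrite andbF orbF => /orP[->//|/andP[_ /eqP ij]]; rewrite -ij i0 in j0.
  rewrite cls_a cls_b; case: ifP => i0; case: ifP => j0; rewrite !le_ptE ?i0 ?j0 //=.
  + by rewrite andbF orbF (ord0_inj i0 j0) eqxx andbT orbC -leq_eqVlt.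
  + by rewrite andbF orbF andbT orbC -leq_eqVlt.
  + by rewrite andbF orbF => ->.
- case: (ptP x) => [->//|[k [i ->]]|[k [i ->]]].
    rewrite cls_a cls_b; case: ifP => i0; case: ifP => j0; rewrite !le_ptE ?i0 ?j0 //=.
    + by rewrite andbF orbF => km; rewrite ltnS ltnW.
    + by rewrite ltnS andbF orbF => /orP[/ltnW//|/andP[/eqP-> _]].
    + by case/orP => [->//|/andP[-> /eqP->]]; rewrite eqxx orbT.
  rewrite !cls_b; case: ifP => i0; case: ifP => j0; rewrite !le_ptE ?i0 ?j0 //=.
  + case/orP => [km|/andP[_ /eqP ij]]; last by rewrite -ij i0 in j0.
    by rewrite andbT orbC -leq_eqVlt.
  + case/orP => [km|/andP[_ /eqP ij]]; last by rewrite ij j0 in i0.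
    by rewrite ltnS ltnW.
Qed.

Lemma cls_le x y : (x <= cls y) = (cls x <= cls y).
Proof.
apply/idP/idP => [/cls_homo|]; first by rewrite cls_idem.
exact: le_trans (cls_ge x).
Qed.

(** [cls] is injective on the points that it moves, namely the b_1^k and the a_m^k with m > 1, so a
    fibre has at most one point besides its closed one. *)
Lemma cls_fibre x y : cls x = cls y -> [\/ x = y, x = cls y | y = cls x].
Proof.
have [cx|/eqP cx] := eqVneq (cls x) x; first by move=> <-; constructor 2.
have [cy|/eqP cy] := eqVneq (cls y) y; first by move=> ->; constructor 3.
move=> e; constructor 1; move: e cx cy.
case: (ptP x) => [->//|[k [i ->]]|[k [i ->]]];
  case: (ptP y) => [->//|[m [j ->]]|[m [j ->]]];
  rewrite ?cls_a ?cls_b; case: ifP => i0; case: ifP => j0 // => /pt_inj[].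
- by move=> -> [->].
- by move=> [->] [->].
Qed.

(** * P-morphisms into X_n^oo that agree up to fibres *)

Section Coincidence.
Context {d : Order.disp_t} {Z : porderType d}.
Variables G H : Z -> X.
Hypothesis n_ge2 : (2 <= n)%N.
Hypothesis width : poset_width_le n Z.
Hypotheses (G_homo : {homo G : u v / u <= v}) (H_homo : {homo H : u v / u <= v}).
Hypothesis G_lift : forall v x, G v <= x -> exists2 w, v <= w & G w = x.
Hypothesis H_lift : forall v x, H v <= x -> exists2 w, v <= w & H w = x.
Hypothesis clsGH : forall v, cls (G v) = cls (H v).

(** Since b_1^k is below every a_j^(k+1), [G] lifts each of them above [v]. There [H] stays above
    a_1^(k+1), and the only point of the fibre of a_j^(k+1) with that property is its top. *)
Lemma gap_lift v k i j : i == 0 :> nat ->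
    G v = pt k (inr i) -> H v = pt k.+1 (inl i) ->
  exists w, [/\ v <= w, G w = pt k.+1 (inl j) & H w = cls (pt k.+1 (inl j))].
Proof.
move=> i0 Gv Hv.
have [|w vw Gw] := @G_lift v (pt k.+1 (inl j)); first by rewrite Gv !le_ptE ltnSn.
exists w; split=> //; move: (H_homo vw) (clsGH w); rewrite Hv Gw.
case: (ptP (H w)) => [->//|[m [l ->]]|[m [l ->]]].
  rewrite !cls_a !le_ptE; case: (eqVneq (l : nat) 0) => [l0|l0].
    by case: ifP => // _ _ ->.
  case: ifP => // _ /orP[km|/andP[_ /eqP il]] /pt_inj[km' _].
    by rewrite km' ltnn in km.
  by rewrite -il i0 in l0.
rewrite cls_a cls_b !le_ptE i0.
case: ifP => j0; case: ifP => l0.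
- move=> /[swap] /pt_inj[[<-] _].
  by rewrite andbF orbF => /ltnW; rewrite ltnn.
- by move=> _ /pt_inj[].
- by move=> _ /pt_inj[].
- by move=> _ ->.
Qed.

(* The (n+1)-antichain: all the [w_j], which [G] sends to the [a_j] of level
   k+1 and [H] to the tops of their classes, and one more point, which [H]
   sends to b_1 of that level. *)
Lemma no_gap_ab v k i : i != 0 :> nat ->
  G v = pt k (inl i) -> H v = pt k (inr i) -> False.
Proof.
move=> i0 Gv Hv.
have z_lt : (0 < n)%N by apply: leq_trans n_ge2.
pose z := Ordinal z_lt; have z0 : z == 0 :> nat by [].
(* As m > 1, a_m lies below b_1. At [u] the map [H] must take a value in {b_1^k, a_1^(k+1)} above
   b_m^k, which leaves a_1^(k+1). *)
have [|u vu Gu] := @G_lift v (pt k (inr z)).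
  by rewrite Gv !le_ptE (negPf i0) !eqxx orbT.
have Hu : H u = pt k.+1 (inl z).
  move: (H_homo vu) (clsGH u); rewrite Hv Gu cls_b z0.
  case: (ptP (H u)) => [->//|[m [l ->]]|[m [l ->]]].
    by rewrite cls_a; case: ifP => // _ _ ->.
  rewrite cls_b !le_ptE; case: ifP => l0 /[swap] /pt_inj[] // [<-] _.
  by rewrite ltnn eqxx /= => /eqP il; rewrite il l0 in i0.
have /choice[w wP] : forall j, exists w, [/\ v <= w, G w = pt k.+1 (inl j)
    & H w = cls (pt k.+1 (inl j))].
  move=> j; have [w [uw Gw Hw]] := gap_lift j z0 Gu Hu.
  by exists w; split=> //; apply: le_trans uw.
have [|t vt Ht] := @H_lift v (pt k.+1 (inr z)); first by rewrite Hv !le_ptE ltnSn.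
(* Under [H] the [w j] go to a_1 and to the b_m with m > 1, all of level k+1; each of these is
   incomparable with b_1, the image of [t]. *)
have tw j : t >< w j.
  have [_ _ Hw] := wP j; rewrite /Order.comparable; apply/norP; split.
  - apply/negP => /H_homo; rewrite Ht Hw cls_a.
    case: ifP => j0; rewrite !le_ptE ltnn eqxx //= => /eqP zj.
    by rewrite -zj in j0.
  - apply/negP => /H_homo; rewrite Ht Hw cls_a.
    by case: ifP => j0; rewrite !le_ptE ?j0 ltnn eqxx //= => /eqP jz; rewrite jz in j0.
have ww j l : j != l -> ~~ (w j <= w l).
  move=> jl; have [_ Gj _] := wP j; have [_ Gl _] := wP l.
  by apply/negP => /G_homo; rewrite Gj Gl !le_ptE ltnn eqxx (negPf jl).
apply: (width (x := v)).
exists (fun r : 'I_n.+1 => if unlift ord0 r is Some j then w j else t).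
split=> [r|r s rs]; first by case: unliftP => [j|] _ //; case: (wP j).
case: (unliftP ord0 r) rs => [j ->|->]; case: (unliftP ord0 s) => [l ->|->];
  rewrite ?eqxx // => jl.
- have jl' : j != l by apply: contraNneq jl => ->.
  by rewrite /Order.comparable negb_or !ww // eq_sym.
- by rewrite comparable_sym.
Qed.

Lemma no_gap v : H v = cls (G v) -> G v = H v.
Proof.
case: (ptP (G v)) => [->//|[k [i Gv]]|[k [i Gv]]]; rewrite Gv.
  rewrite cls_a; case: ifP => [//|/negbT i0] Hv.
  by case: (no_gap_ab i0 Gv Hv).
rewrite cls_b; case: ifP => [i0 Hv|//].
(* Here [j] has value 1, that is, m = 2: the gap at b_1^k moves up to one between a_2^(k+1) and
   b_2^(k+1), which is already excluded. *)
pose j := Ordinal n_ge2; have [w [_ Gw Hw]] := gap_lift j i0 Gv Hv.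
by case: (@no_gap_ab w k.+1 j).
Qed.

End Coincidence.

(** In each fibre one of the two values is the closure of the other; [no_gap] applies either as it
    stands or with [G] and [H] exchanged. *)
Lemma coincidence {d} {Z : porderType d} (G H : Z -> X) :
    (2 <= n)%N -> poset_width_le n Z ->
    {homo G : u v / u <= v} -> {homo H : u v / u <= v} ->
    (forall v x, G v <= x -> exists2 w, v <= w & G w = x) ->
    (forall v x, H v <= x -> exists2 w, v <= w & H w = x) ->
    (forall v, cls (G v) = cls (H v)) ->
  forall v, G v = H v.
Proof.
move=> n2 wd Gh Hh Gl Hl e v.
have [//|Gv|Hv] := cls_fibre (e v); first by apply/esym/(no_gap (H := G)).
exact: no_gap Hv.
Qed.

End OmegaSumXX.

(** * The proper epic subalgebra of saturated elements *)

Section SaturatedSubalgebra.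
Local Open Scope classical_set_scope.
Local Open Scope order_scope.
Lemma open_dual_basic {d} {A : heytingType d} (a : A) :
  open [set F : dual A | val F a].
Proof.
pose U := [set F : dual A | val F a].
exists [set U]; last by rewrite bigcup_set1.
by move=> _ ->; apply: (finI_from1 id); exists a; left.
Qed.

Context {n : nat} {d : Order.disp_t} {A : heytingType d}.
Notation X := (omega_sum (XX n)).
Variables (f : dual A -> X) (g : X -> dual A).
Hypotheses (fK : cancel f g) (gK : cancel g f).
Hypotheses (g_cont : continuous g) (f_mono : {mono f : x y / x <= y}).

Lemma dual_pf (F : dual A) : prime_filter (val F).
Proof. exact/asboolP/(valP F). Qed.

Lemma g_mono : {mono g : x y / x <= y}.
Proof. by move=> x y; rewrite -f_mono !gK. Qed.

Lemma g_sep x y : ~~ (x <= y) -> exists2 a, val (g x) a & ~ val (g y) a.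
Proof.
rewrite -g_mono => /asboolPn nxy; apply: contrapT => na; apply: nxy => a xa.
by apply: contrapT => ya; apply: na; exists a.
Qed.

(** This is the Kripke clause for implication; completeness of the clause rests on prime
    extensions. *)
Lemma g_himp x a b : val (g x) (himp a b) <->
  forall y, x <= y -> val (g y) a -> val (g y) b.
Proof.
split=> [xab y|xab].
  rewrite -g_mono => /asboolP xy.
  by apply: filter_mp (prime_is_filter (dual_pf _)) (xy _ xab).
apply: contrapT => /(prime_himp_ext (dual_pf _))[P [pP xP Pa nPb]].
have PP : `[< prime_filter P >] by apply/asboolP.
pose F : dual A := exist _ P PP.
apply: nPb; have := xab (f F); rewrite -g_mono fK /=; apply=> //.
exact/asboolP.
Qed.

(* At T the openness of a basic upset yields a whole tail of levels, so only
   finitely many points remain to be covered. *)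
Lemma compl_down_basic (y : X) : y <> None ->
  exists a, forall x, val (g x) a <-> ~~ (x <= y).
Proof.
move=> yN.
have [t gt ngt] : exists2 t, val (g None) t & ~ val (g y) t.
  by apply: g_sep; case: y yN.
have [_ /(_ gt)[k tail]] : sum_open [set x | val (g x) t].
  by move/continuousP: g_cont => /(_ _ (open_dual_basic t)).
(* A finite join of elements separating the listed points from [y] still misses [y], because [g y]
   is prime. *)
have fin (s : seq X) : exists a, ~ val (g y) a /\
    forall x, x \in s -> ~~ (x <= y) -> val (g x) a.
  elim: s => [|z s [a [ya sa]]].
    by exists \bot; split=> //; apply: pf_bot; apply: dual_pf.
  have [zy|/g_sep[b zb yb]] := boolP (z <= y).
    exists a; split=> // x; rewrite inE => /predU1P[->|/sa//]; by rewrite zy.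
  exists (a `|` b); split; first by move/(pf_prime (dual_pf _)) => -[].
  move=> x; rewrite inE => /predU1P[-> _|xs /(sa _ xs) xa].
    by apply: (pf_up (dual_pf _)) zb _; apply: leUr.
  by apply: (pf_up (dual_pf _)) xa _; apply: leUl.
(* The list consists of all points of levels below [k]; [t] takes care of the other levels and of
   T. *)
have [a [ya sa]] := fin [seq pt m x | m <- iota 0 k, x <- enum {: 'I_n + 'I_n}].
have nyat : ~ val (g y) (t `|` a) by move/(pf_prime (dual_pf _)) => -[].
exists (t `|` a) => x; split=> [xat|nxy].
  by apply/negP; rewrite -g_mono => /asboolP /(_ _ xat).
case: x nxy => [[m x] nxy|_]; last first.
  by apply: (pf_up (dual_pf _)) gt _; apply: leUl.
have [km|mk] := leqP k m.
  by apply: (pf_up (dual_pf _)) (tail m x km) _; apply: leUl.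
apply: (pf_up (dual_pf _)) (sa _ _ nxy) _; last exact: leUr.
by apply/allpairsP; exists (m, x); rewrite mem_iota /= mem_enum.
Qed.

(** Elements give upsets and [cls] is increasing, so the converse implication is automatic and the
    upset is a union of fibres. *)
Definition saturated : set A :=
  [set a | forall x, val (g (cls x)) a -> val (g x) a].

Lemma val_g_up x y a : x <= y -> val (g x) a -> val (g y) a.
Proof. by rewrite -g_mono => /asboolP; apply. Qed.

(** For implication, a point y ≥ x with [a] is moved up to cls y ≥ cls x, where [b] holds, and
    saturation of [b] brings it back to y. *)
Lemma saturated_closed : heyting_closed saturated.
Proof.
split=> [a b sa sb x ab|a b sa sb x /(pf_prime (dual_pf _)) ab|a b sa sb x||x _].
- apply: (pf_meet (dual_pf _)).
    by apply: sa; apply: (pf_up (dual_pf _)) ab (leIl _ _).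
  by apply: sb; apply: (pf_up (dual_pf _)) ab (leIr _ _).
- case: ab => [/sa xa|/sb xb].
    by apply: (pf_up (dual_pf _)) xa (leUl _ _).
  by apply: (pf_up (dual_pf _)) xb (leUr _ _).
- move=> /g_himp ab; apply/g_himp => y xy ya; apply: sb.
  by apply: ab; [apply: cls_homo | apply: val_g_up ya; apply: cls_ge].
- by move=> x /(pf_bot (dual_pf _)).
- exact: pf_top (dual_pf _).
Qed.

(** The complement of the downset of [cls y] is a union of fibres, by [cls_le]. *)
Lemma saturated_sep x y : ~~ (cls x <= cls y) ->
  exists a, [/\ saturated a, val (g x) a & ~ val (g y) a].
Proof.
move=> xy; have yN : cls y <> None by move=> e; rewrite e le_None in xy.
have [a aP] := compl_down_basic yN.
exists a; split.
- by move=> z /aP cz; apply/aP; rewrite cls_le.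
- by apply/aP; rewrite cls_le.
- by move/aP; rewrite cls_ge.
Qed.

Lemma saturated_proper : (2 <= n)%N -> exists a, ~ saturated a.
Proof.
move=> n2; pose j := Ordinal n2.
have [|a ba aa] := @g_sep (pt 0 (inr j)) (pt 0 (inl j)).
  by rewrite le_pt ltnn eqxx.
by exists a => /(_ (pt 0 (inl j))); rewrite cls_a /= => /(_ ba).
Qed.

Lemma saturated_epimorphism (K : heytingClass) : (2 <= n)%N ->
    (forall d' (C : heytingType d'), K d' C -> heyting_width_le n C) ->
  epimorphism K (val : subalgebra saturated_closed -> A).
Proof.
move=> n2 wd d' C h1 h2 KC hom1 hom2 e.
pose G1 (P : dual C) : X := f (dual_map hom1 P).
pose G2 (P : dual C) : X := f (dual_map hom2 P).
have agree a : saturated a -> h1 a = h2 a.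
  move=> /mem_set sa.
  by have := congr1 (fun h => h (exist _ a sa : subalgebra saturated_closed)) e.
have homo h (hh : heyting_hom h) :
    {homo (fun P : dual C => f (dual_map hh P)) : P Q / P <= Q}.
  by move=> P Q PQ; rewrite f_mono; apply: dual_map_homo.
have lift h (hh : heyting_hom h) (P : dual C) x :
    f (dual_map hh P) <= x -> exists2 Q, P <= Q & f (dual_map hh Q) = x.
  rewrite -{1}[x]gK f_mono => /dual_map_lift[Q PQ eQ].
  by exists Q => //; rewrite eQ gK.
(* Saturated elements separate distinct fibres, so homomorphisms agreeing on them have dual maps
   that agree after [cls]. *)
have clsle h h' (hh : heyting_hom h) (hh' : heyting_hom h') (P : dual C) :
    (forall a, saturated a -> h a = h' a) ->
    cls (f (dual_map hh P)) <= cls (f (dual_map hh' P)).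
  move=> hE; apply: contrapT => /negP /saturated_sep[a []] /hE ha.
  by rewrite !fK /= ha.
have E : forall P, G1 P = G2 P.
  apply: coincidence; [exact: n2|exact: wd|exact: homo|exact: homo
                      |exact: lift|exact: lift|].
  move=> P; apply/le_anti/andP; split; apply: clsle => // a /agree->//.
(* Prime filters of [C] separate its elements, so a homomorphism is determined by its dual map. *)
have sep h h' (hh : heyting_hom h) (hh' : heyting_hom h') a :
    (forall P : dual C, f (dual_map hh P) = f (dual_map hh' P)) -> h a <= h' a.
  move=> hE; apply: contrapT => /negP /prime_separation[P [pP Pa nPa]].
  have PP : `[< prime_filter P >] by apply/asboolP.
  apply: nPa; have /(congr1 g) := hE (exist _ P PP); rewrite !fK.
  by move/(congr1 val)/(congr1 (fun S : set A => S a)) => /= <-.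
apply/funext => a; apply/le_anti/andP; split.
  exact: sep E.
by apply: sep => P; apply/esym/E.
Qed.

End SaturatedSubalgebra.

Theorem theorem6p5 (n : nat) (K : heytingClass)
    (hn : 2 <= n) (hK : variety K)
    (hwidth : forall (d : Order.disp_t) (A : heytingType d),
      K d A -> heyting_width_le n A)
    (hX : dual_class K (omega_sum (XX n))) :
  ~ ES_property K.
Proof.
move=> ES; have [_ [d [A [KA [f [g [fK gK _ g_cont f_mono]]]]]]] := hX.
have [a na] := saturated_proper gK f_mono hn.
pose cS := saturated_closed fK gK f_mono.
have [s sa] := ES _ _ _ _ _ (subalgebra_variety cS hK KA) KA (subalgebra_hom cS)
  (saturated_epimorphism g_cont hn hwidth) a.
by apply: na; rewrite -sa; apply/set_mem/valP.
Qed.
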